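(* Let $G$ be a torsion-free abelian group of infinite rank for which the length of any direct decomposition into indecomposable summands is bounded by some fixed integer. Then $G$ has a decomposition $G = A \oplus H$ where $A$ is completely decomposable of finite rank and $H$ is clipped.
   Context: The length of a direct decomposition of a torsion-free abelian group is the number of its summands. A torsion-free abelian group is completely decomposable if it is a direct sum (possibly empty) of groups of rank $1$; it is clipped if it has no direct summand of rank $1$.
   Formalization: It is additionally assumed that every direct summand of G (G included) is a direct sum of indecomposable groups; without this the bound can hold vacuously and the claim fails, e.g. for a free group of infinite rank plus a p-divisible group with no indecomposable summands. *)

(* Defs.v *)
From HB Require Import structures.
From mathcomp Require Import all_boot all_order all_algebra.
From mathcomp Require Import boolp classical_sets cardinality.

Set Implicit Arguments.
Unset Strict Implicit.
Unset Printing Implicit Defensive.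

Import GRing.Theory.
Local Open Scope classical_set_scope.
Local Open Scope card_scope.
Local Open Scope ring_scope.

Definition torsion_free (G : zmodType) : Prop :=
  forall (x : G) (n : nat), (0 < n)%N -> x *+ n = 0 -> x = 0.

Section Subgroups.
Variable G : zmodType.
Implicit Types (A B C H X Y : set G).

Definition subgroup A : Prop :=
  A 0 /\ (forall x y, A x -> A y -> A (x - y)).

Definition lin_independent X : Prop :=
  forall (s : seq G) (c : G -> int),
    uniq s -> (forall x, x \in s -> X x) ->
    \sum_(x <- s) x *~ c x = 0 -> forall x, x \in s -> c x = 0.

Definition maximal_independent A X : Prop :=
  [/\ X `<=` A, lin_independent X &
      forall Y, X `<=` Y -> Y `<=` A -> lin_independent Y -> Y = X].

(* In a torsion-free group all maximal independent subsets of a subgroup have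
   the same cardinality, so [has_rank A] holds of at most one [n]. *)
Definition has_rank A (n : nat) : Prop :=
  exists X, maximal_independent A X /\ X #= `I_n.

Definition finite_rank A : Prop := exists n, has_rank A n.

Definition infinite_rank A : Prop := ~ finite_rank A.

Definition direct_sum2 B A H : Prop :=
  [/\ subgroup A, subgroup H,
      B = [set x | exists a h, [/\ A a, H h & x = a + h]] &
      A `&` H = [set 0]].

Definition direct_summand B A : Prop := exists H, direct_sum2 B A H.

(* The index type [I] is arbitrary: infinite families are allowed, and the
   empty family decomposes [set 0]. *)
Definition direct_sum B (I : eqType) (F : I -> set G) : Prop :=
  [/\ forall i, subgroup (F i),
      B = [set x | exists (s : seq I) (f : I -> G),
             (forall i, F i (f i)) /\ x = \sum_(i <- s) f i] &
      forall (s : seq I) (f : I -> G), uniq s -> (forall i, F i (f i)) ->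
        \sum_(i <- s) f i = 0 -> forall i, i \in s -> f i = 0].

Definition indecomposable B : Prop :=
  [/\ subgroup B, B <> [set 0] &
      forall C D, direct_sum2 B C D -> C = [set 0] \/ D = [set 0]].

Definition indecomposable_decomposition B (I : eqType) (F : I -> set G) : Prop :=
  direct_sum B F /\ (forall i, indecomposable (F i)).

(* The length of a decomposition is the cardinality of its index type. *)
Definition length_le (I : eqType) (F : I -> set G) (n : nat) : Prop :=
  [set: I] #<= `I_n.

Definition completely_decomposable A : Prop :=
  exists (I : eqType) (F : I -> set G),
    direct_sum A F /\ (forall i, has_rank (F i) 1).

Definition clipped H : Prop :=
  ~ exists R, direct_summand H R /\ has_rank R 1.

End Subgroups.

(* Main.v *)
(* Split rank-one summands off G one at a time: G = R_1 + ... + R_k + H.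
   A torsion-free group of rank one is indecomposable, since any two of its
   nonzero elements have a common nonzero multiple. Adjoining R_1, ..., R_k to
   an indecomposable decomposition of H therefore gives one of G of length at
   least k, so k is at most the given bound and the process stops, which
   happens exactly when H is clipped. *)
Require Import Defs.
From HB Require Import structures.
From mathcomp Require Import all_boot all_order all_algebra.
From mathcomp Require Import boolp classical_sets functions cardinality.

Set Implicit Arguments.
Unset Strict Implicit.
Unset Printing Implicit Defensive.

Import GRing.Theory.
Local Open Scope classical_set_scope.
Local Open Scope card_scope.
Local Open Scope ring_scope.

Lemma torsion_free_mulrz (G : zmodType) (x : G) (m : int) :
  torsion_free G -> m != 0 -> x *~ m = 0 -> x = 0.
Proof.
move=> tf; case: m => [[//|n]|n] _; first by rewrite -pmulrn; exact: tf.
by rewrite NegzE mulrNz -pmulrn => /eqP; rewrite oppr_eq0 => /eqP; exact: tf.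
Qed.

(** * Subgroups and internal direct sums of two subgroups *)

Section Subgroup.
Variable G : zmodType.
Implicit Types A B H R K : set G.

Lemma subgroupN A x : subgroup A -> A x -> A (- x).
Proof. by case=> A0 AB Ax; rewrite -sub0r; exact: AB. Qed.

Lemma subgroupD A x y : subgroup A -> A x -> A y -> A (x + y).
Proof.
by move=> sA Ax Ay; rewrite -[y]opprK; apply: sA.2 => //; exact: subgroupN.
Qed.

Lemma subgroup_sum A (T : eqType) (s : seq T) (P : pred T) (f : T -> G) :
  subgroup A -> (forall i, i \in s -> P i -> A (f i)) ->
  A (\sum_(i <- s | P i) f i).
Proof.
move=> sA Af; rewrite big_seq_cond.
by apply: big_ind => [|x y|i /andP[]]; [exact: sA.1|exact: subgroupD|exact: Af].
Qed.

Lemma subgroupMz A x m : subgroup A -> A x -> A (x *~ m).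
Proof.
move=> sA Ax; have An n : A (x *+ n).
  by elim: n => [|n IH]; [exact: sA.1|rewrite mulrS; exact: subgroupD].
case: m => n; first exact: An.
by rewrite NegzE mulrNz; apply: subgroupN => //; exact: An.
Qed.

Lemma subgroup_set0 : subgroup [set 0 : G].
Proof. by split=> // x y -> ->; rewrite subr0. Qed.

End Subgroup.

Section DirectSum2.
Variable G : zmodType.
Implicit Types A B H R K : set G.

Lemma direct_sum2I B A H x : direct_sum2 B A H -> A x -> H x -> x = 0.
Proof.
by case=> _ _ _ AH Ax Hx; have : (A `&` H) x by []; rewrite AH.
Qed.

Lemma direct_sum2_zero B A H a h :
  direct_sum2 B A H -> A a -> H h -> a + h = 0 -> a = 0 /\ h = 0.
Proof.
move=> dB Aa Hh /eqP; rewrite addr_eq0 => /eqP ah; have [sA sH _ _] := dB.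
have a0 : a = 0 by apply: (direct_sum2I dB) => //; rewrite ah; exact: subgroupN.
by split=> //; rewrite -[h]opprK -ah a0 oppr0.
Qed.

Lemma direct_sum2_subl B A H : direct_sum2 B A H -> A `<=` B.
Proof.
case=> _ sH -> _ a Aa; exists a, 0; rewrite addr0.
by split=> //; exact: sH.1.
Qed.

Lemma direct_sum2_sym B A H : direct_sum2 B A H -> direct_sum2 B H A.
Proof.
case=> sA sH -> AH; split=> //; last by rewrite setIC.
by apply/seteqP; split=> x [a [h [? ? ->]]]; exists h, a; rewrite addrC.
Qed.

Lemma direct_sum2_subgroup B A H : direct_sum2 B A H -> subgroup B.
Proof.
case=> sA sH -> _; split; first by exists 0, 0; rewrite addr0; split=> //; [exact: sA.1|exact: sH.1].
move=> _ _ [a [h [Aa Hh ->]]] [a' [h' [Aa' Hh' ->]]].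
exists (a - a'), (h - h'); split; [exact: sA.2|exact: sH.2|].
by rewrite opprD addrACA.
Qed.

Lemma direct_sum2_zerol H : subgroup H -> direct_sum2 H [set 0] H.
Proof.
move=> sH; split=> //; first exact: subgroup_set0.
  apply/seteqP; split=> [x Hx|_ [_ [h [-> Hh ->]]]]; last by rewrite add0r.
  by exists 0, x; rewrite add0r.
by apply/seteqP; split=> [x []//|_ ->]; split=> //; exact: sH.1.
Qed.

(** This regroups [A + (R + K)] as [(A + R) + K]: a summand [R] split off the complement [H] is
    moved over to the part already split off. *)
Lemma direct_sum2_assoc B A H R K :
  direct_sum2 B A H -> direct_sum2 H R K ->
  exists A', direct_sum2 A' A R /\ direct_sum2 B A' K.
Proof.
move=> dB dH; have [sA sH BE AH] := dB; have [sR sK HE RK] := dH.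
pose A' := [set x | exists a r, [/\ A a, R r & x = a + r]].
have dA' : direct_sum2 A' A R.
  split=> //; apply/seteqP; split=> [x [Ax Rx]|_ ->]; last by split; [exact: sA.1|exact: sR.1].
  by apply: (direct_sum2I dB) => //; exact: direct_sum2_subl dH _ Rx.
exists A'; split=> //; split=> //; first exact: direct_sum2_subgroup dA'.
  rewrite BE HE; apply/seteqP; split=> x.
    move=> [a [_ [Aa [r [k [Rr Kk ->]]] ->]]].
    by exists (a + r), k; split=> //; [exists a, r|rewrite addrA].
  move=> [_ [k [[a [r [Aa Rr ->]]] Kk ->]]].
  by exists a, (r + k); split=> //; [exists r, k|rewrite addrA].
apply/seteqP; split=> [x [[a [r [Aa Rr xE]]] Kx]|_ ->]; last first.
  split; last exact: sK.1.
  by exists 0, 0; rewrite addr0; split=> //; [exact: sA.1|exact: sR.1].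
(* For [x = a + r] in [K], the relation [a + (r - x) = 0] has its second term in [H]. Hence [a = 0],
   and [x = r] lies in both [R] and [K]. *)
have Hrx : H (r - x).
  by apply: sH.2; [exact: direct_sum2_subl dH _ Rr|exact: direct_sum2_subl (direct_sum2_sym dH) _ Kx].
have [a0 _] : a = 0 /\ r - x = 0.
  by apply: (direct_sum2_zero dB) => //; rewrite addrA -xE subrr.
by apply: (direct_sum2I dH) => //; rewrite xE a0 add0r.
Qed.

End DirectSum2.

(** * Finite rational bases and rank *)

Section Basis.
Variable G : zmodType.
Implicit Types (A B H R : set G) (t : seq G).

(** A relation on part of [t] extends to all of [t] by zero coefficients, so only relations on the
    full list need testing. *)
Lemma lin_independent_seq t : uniq t ->
  lin_independent [set` t] <->
  (forall c : G -> int, \sum_(x <- t) x *~ c x = 0 ->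
     forall x, x \in t -> c x = 0).
Proof.
move=> ut; split=> [it c|it s c us st s0 x xs]; first exact: it.
pose c' y := if y \in s then c y else 0.
suff /it/(_ x (st x xs)) : \sum_(y <- t) y *~ c' y = 0 by rewrite /c' xs.
transitivity (\sum_(y <- t | y \in s) y *~ c y).
  by rewrite [RHS]big_mkcond; apply: eq_bigr => y _; rewrite /c'; case: ifP.
rewrite -big_filter -[RHS]s0; apply: perm_big; apply: uniq_perm => //.
  exact: filter_uniq.
by move=> y; rewrite mem_filter; case ys: (y \in s) => //=; exact: st.
Qed.

(* In a torsion-free group: a finite rational basis of the divisible hull. *)
Definition basis A t : Prop :=
  [/\ uniq t, [set` t] `<=` A, lin_independent [set` t] &
      forall a, A a -> exists2 m : int, m != 0 &
        exists c : G -> int, a *~ m = \sum_(x <- t) x *~ c x].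

Lemma basis_neq0 A t x : basis A t -> x \in t -> x != 0.
Proof.
case=> ut _ it _ xt; apply/eqP => x0.
have : (fun=> 1 : int) x = 0.
  apply: (it [:: x] (fun=> 1)) => //.
  - by move=> y; rewrite inE => /eqP->.
  - by rewrite big_seq1 x0 mul0rz.
  - by rewrite inE.
by [].
Qed.

(** Adjoining [a] to the independent list [t] creates a nontrivial relation exactly when some
    nonzero multiple of [a] is a combination of [t]; maximality says that this happens for every [a]
    of [A] outside [t]. *)
Lemma maximal_independentP A t : uniq t ->
  maximal_independent A [set` t] <-> basis A t.
Proof.
move=> ut; split=> [[tA it tmax]|[_ tA it tspan]].
  split=> // a Aa; case: (boolP (a \in t)) => [at_|at_].
    exists 1 => //; exists (fun x => (x == a)%:Z).
    rewrite mulr1z (bigD1_seq a) //= eqxx mulr1z big1 ?addr0// => x xa.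
    by rewrite (negbTE xa) mulr0z.
  apply: contrapT => nspan.
  have uat : uniq (a :: t) by rewrite /= at_.
  suff iat : lin_independent [set` a :: t].
    have E : [set` a :: t] = [set` t].
      apply: tmax => //; first by move=> x /= xt; rewrite inE xt orbT.
      by move=> x /=; rewrite inE => /orP[/eqP->//|]; exact: tA.
    have : [set` a :: t] a by rewrite /= mem_head.
    by rewrite E /= (negbTE at_).
  (* In a relation on [a :: t], a nonzero coefficient of [a] would make a multiple of [a] a
     combination of [t]; once it is zero, the independence of [t] kills the other coefficients. *)
  apply/(lin_independent_seq uat) => c; rewrite big_cons => s0.
  have ca0 : c a = 0.
    apply: contrapT => /eqP ca; apply: nspan; exists (c a) => //.
    exists (fun x => - c x); move/eqP: s0; rewrite addr_eq0 => /eqP->.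
    by rewrite -sumrN; apply: eq_bigr => x _; rewrite mulrNz.
  move: s0; rewrite ca0 mulr0z add0r => /(it _ _ ut (fun _ h => h)) ct0 x.
  by rewrite inE => /orP[/eqP->//|]; exact: ct0.
split=> // Y tY YA iY; apply/seteqP; split=> // y Yy.
apply: contrapT => /= /negP yt; have [m m0 [c ymE]] := tspan y (YA _ Yy).
(* The spanning equation for [y], with all terms moved to one side, is a relation on [y :: t] with
   coefficient [m != 0] at [y], against the independence of [Y]. *)
have uyt : uniq (y :: t) by rewrite /= yt.
have /(iY _ (fun x => if x == y then m else - c x) uyt) :
    forall x, x \in y :: t -> Y x.
  by move=> x; rewrite inE => /orP[/eqP->//|]; exact: tY.
suff -> : \sum_(x <- y :: t) x *~ (if x == y then m else - c x) = 0.
  by move=> /(_ erefl y (mem_head _ _)); rewrite eqxx => /eqP; rewrite (negbTE m0).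
rewrite big_cons eqxx ymE -big_split big_seq big1//= => x xt.
by case: eqP => [xy|_]; [move: yt; rewrite -xy xt|rewrite mulrNz subrr].
Qed.

Lemma finite_rankP A : finite_rank A <-> exists t, basis A t.
Proof.
split=> [[n [X [mX Xn]]]|[t bt]].
  have /finite_seqP[s XE] : finite_set X by apply/finite_setP; exists n.
  have XE' : X = [set` undup s].
    by rewrite XE; apply/seteqP; split=> x /=; rewrite mem_undup.
  by exists (undup s); apply/maximal_independentP; rewrite ?undup_uniq -?XE'.
have : finite_set [set` t] by apply/finite_seqP; exists t.
case/finite_setP => n tn; exists n, [set` t]; split=> //.
by apply/maximal_independentP => //; case: bt.
Qed.

Lemma rank1_basis R : has_rank R 1 -> exists x, basis R [:: x].
Proof.
(* Removing a suitable point [x] from a set of cardinality one leaves nothing, so [X] is the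
   singleton of [x]. *)
case=> X [mX X1]; have /eq_cardSP[x Xx] := X1; rewrite II0 card_eq0 => /eqP X0.
exists x; apply/maximal_independentP => //.
suff -> : [set` [:: x]] = X by [].
apply/seteqP; split=> y /=; rewrite inE; first by move/eqP->.
move=> Xy; apply: contrapT => /negP/eqP yx.
by suff : (X `\ x) y by rewrite X0.
Qed.

Lemma finite_rank_set0 : finite_rank [set 0 : G].
Proof.
apply/finite_rankP; exists [::]; split=> //.
  exact/lin_independent_seq.
by move=> _ ->; exists 1 => //; exists (fun=> 0); rewrite big_nil mul0rz.
Qed.

(** A relation on [s ++ t] has an [A] part and an [H] part with sum zero; both vanish because the
    sum is direct, and each list is independent. *)
Lemma basis_cat B A H s t :
  direct_sum2 B A H -> basis A s -> basis H t -> basis B (s ++ t).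
Proof.
move=> dB bs bt; have [sA sH BE _] := dB.
have [us sS is_ ss] := bs; have [ut tS it ts] := bt.
have dst x : x \in s -> x \notin t.
  move=> xs; apply/negP => xt; have /eqP[] := basis_neq0 bs xs.
  by apply: (direct_sum2I dB); [exact: sS|exact: tS].
have ust : uniq (s ++ t).
  rewrite cat_uniq us ut andbT /=; apply/hasPn => x xt.
  by apply/negP => /dst; rewrite xt.
split=> //.
- move=> x /=; rewrite mem_cat => /orP[xs|xt].
    by apply: (direct_sum2_subl dB); exact: sS.
  by apply: (direct_sum2_subl (direct_sum2_sym dB)); exact: tS.
- apply/lin_independent_seq => // c; rewrite big_cat /= => c0.
  have [cs ct] : \sum_(x <- s) x *~ c x = 0 /\ \sum_(x <- t) x *~ c x = 0.
    apply: (direct_sum2_zero dB) => //.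
      by apply: subgroup_sum => // x xs _; apply: subgroupMz => //; exact: sS.
    by apply: subgroup_sum => // x xt _; apply: subgroupMz => //; exact: tS.
  move=> x; rewrite mem_cat => /orP[].
    exact: (lin_independent_seq us).1.
  exact: (lin_independent_seq ut).1.
- move=> x; rewrite BE => -[a [h [Aa Hh ->]]].
  have [m m0 [c aE]] := ss a Aa; have [n n0 [d hE]] := ts h Hh.
  (* The product is a common multiplier for [a] and [h], so the coefficients of [a] are scaled by
     [n] and those of [h] by [m]. *)
  exists (m * n); first by rewrite mulf_neq0.
  exists (fun x => if x \in s then c x * n else d x * m).
  rewrite mulrzDl big_cat; congr (_ + _).
    rewrite mulrzA aE mulrz_suml big_seq [RHS]big_seq.
    by apply: eq_bigr => y ->; rewrite mulrzA.
  rewrite mulrC mulrzA hE mulrz_suml big_seq [RHS]big_seq.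
  apply: eq_bigr => y yt; case: ifP => [/dst|_]; first by rewrite yt.
  by rewrite mulrzA.
Qed.

Lemma finite_rank_direct_sum2 B A H :
  direct_sum2 B A H -> finite_rank A -> finite_rank H -> finite_rank B.
Proof.
move=> dB /finite_rankP[s bs] /finite_rankP[t bt]; apply/finite_rankP.
by exists (s ++ t); exact: basis_cat dB _ _.
Qed.

Lemma rank1_indecomposable R :
  torsion_free G -> subgroup R -> has_rank R 1 -> indecomposable R.
Proof.
move=> tf sR /rank1_basis[x bx]; have [_ xR _ span] := bx; split=> //.
  move=> R0; have : R x by apply: xR; rewrite /= mem_head.
  by rewrite R0 => x0; have := basis_neq0 bx (mem_head _ _); rewrite x0 eqxx.
move=> C D dR; apply: contrapT => /not_orP[C0 D0]; have [sC sD _ _] := dR.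
(* A nonzero [e] in [E] has a nonzero multiple equal to an integer multiple of [x]; that integer is
   nonzero, for otherwise torsion-freeness would give [e = 0]. *)
have nonzero E : subgroup E -> E `<=` R -> E <> [set 0] ->
    exists2 k : int, k != 0 & E (x *~ k).
  move=> sE ER E0; have [e Ee e0] : exists2 e, E e & e <> 0.
    apply: contrapT => nE; apply: E0; apply/seteqP; split=> [e Ee|_ ->].
      by apply: contrapT => e0; apply: nE; exists e.
    exact: sE.1.
  have [m m0 [c]] := span e (ER _ Ee); rewrite big_seq1 => emE.
  exists (c x); last by rewrite -emE; exact: subgroupMz.
  apply/eqP => cx0; apply: e0; apply: (torsion_free_mulrz tf m0).
  by rewrite emE cx0 mulr0z.
have [p p0 Cp] := nonzero C sC (direct_sum2_subl dR) C0.
have [q q0 Dq] := nonzero D sD (direct_sum2_subl (direct_sum2_sym dR)) D0.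
(* The element [x *~ (p * q)] is a multiple of both [x *~ p] and [x *~ q], so it lies in [C] and in
   [D] and is zero, which forces [x = 0]. *)
have /eqP[] := basis_neq0 bx (mem_head _ _).
apply: (torsion_free_mulrz tf (mulf_neq0 p0 q0)); apply: (direct_sum2I dR).
  by rewrite mulrzA; exact: subgroupMz.
by rewrite mulrC mulrzA; exact: subgroupMz.
Qed.

End Basis.

(** * Direct sums of families and their concatenation *)

Section DirectSum.
Variable G : zmodType.
Implicit Types A B H R : set G.

Lemma direct_sum_sub B (I : eqType) (F : I -> set G) i :
  direct_sum B F -> F i `<=` B.
Proof.
case=> sF -> _ x Fx; exists [:: i], (fun j => if j == i then x else 0).
split; last by rewrite big_seq1 eqxx.
by move=> j; case: eqP => [->//|_]; exact: (sF j).1.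
Qed.

Lemma direct_sum_void (F : void -> set G) : direct_sum [set 0] F.
Proof.
split=> [[]||s f _ _ _ []]; apply/seteqP; split=> [_ ->|_ [[|[]] [f [_ ->]]]].
  by exists [::], (fun=> 0); split=> [[]|]; rewrite big_nil.
by rewrite big_nil.
Qed.

Lemma direct_sum_unit A : subgroup A -> direct_sum A (fun _ : unit => A).
Proof.
move=> sA; split=> // [|s f us fA].
  apply/seteqP; split=> [x Ax|_ [s [f [fA ->]]]]; last exact: subgroup_sum.
  by exists [:: tt], (fun=> x); rewrite big_seq1.
case: s us => [|[] [|[] s]] //= _; rewrite big_seq1 => f0 [] _; exact: f0.
Qed.

Lemma sum_projections (I J : Type) (s : seq (I + J)) (f : I + J -> G) :
  \sum_(u <- s) f u =
  \sum_(i <- pmap (fun u => if u is inl i then Some i else None) s) f (inl i) +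
  \sum_(j <- pmap (fun u => if u is inr j then Some j else None) s) f (inr j).
Proof.
elim: s => [|[i|j] s IH] /=; rewrite ?big_nil ?addr0// !big_cons IH.
  by rewrite addrA.
by rewrite addrCA.
Qed.

Definition sum_family (I J : Type) (F : I -> set G) (E : J -> set G) u :=
  match u with inl i => F i | inr j => E j end.

(** A vanishing sum over [I + J] separates into its [inl] terms, lying in [A], and its [inr] terms,
    lying in [H]. Both partial sums vanish, and directness of each family applies. *)
Lemma direct_sum_sum B A H (I J : eqType) (F : I -> set G) (E : J -> set G) :
  direct_sum2 B A H -> direct_sum A F -> direct_sum H E ->
  direct_sum B (sum_family F E).
Proof.
move=> dB dA dH; have [sA sH BE _] := dB.
have [sF AE iF] := dA; have [sE HE iE] := dH; split=> [[]//||s f us fFE].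
  apply/seteqP; split=> [x|_ [s [f [fFE ->]]]].
    rewrite BE AE HE => -[_ [_ [[s [f [fF ->]]] [t [g [gE ->]]] ->]]].
    exists (map inl s ++ map inr t).
    exists (fun u => match u with inl i => f i | inr j => g j end).
    by split=> [[]//|]; rewrite big_cat !big_map.
  apply: subgroup_sum; first exact: direct_sum2_subgroup dB.
  move=> u _ _; have := fFE u; case: u => [i|j] /= fu.
    exact: direct_sum2_subl dB _ (direct_sum_sub dA fu).
  exact: direct_sum2_subl (direct_sum2_sym dB) _ (direct_sum_sub dH fu).
rewrite sum_projections.
set s1 := pmap _ _; set s2 := pmap _ _ => /(direct_sum2_zero dB)[].
- by apply: subgroup_sum => // i _ _; apply: (direct_sum_sub dA); exact: (fFE (inl i)).
- by apply: subgroup_sum => // j _ _; apply: (direct_sum_sub dH); exact: (fFE (inr j)).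
have us1 : uniq s1 by apply: (pmap_uniq (g := inl)) us => -[].
have us2 : uniq s2 by apply: (pmap_uniq (g := inr)) us => -[].
move=> f1 f2 [i|j] us'.
  apply: (iF s1 (f \o inl)) => //; first by move=> k; exact: (fFE (inl k)).
  by rewrite mem_pmap; apply/mapP; exists (inl i).
apply: (iE s2 (f \o inr)) => //; first by move=> k; exact: (fFE (inr k)).
by rewrite mem_pmap; apply/mapP; exists (inr j).
Qed.

End DirectSum.

(** * Splitting off rank-one summands and bounding their number *)

Section RankOneSummands.
Variable G : zmodType.

(** The state after [k] splittings. The index type is finite so that [k] can be compared with the
    bound on lengths. *)
Definition splits_rank1 (k : nat) (A H : set G) : Prop :=
  [/\ direct_sum2 [set: G] A H, finite_rank A &
      exists (I : finType) (F : I -> set G),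
        [/\ #|I| = k, direct_sum A F & forall i, has_rank (F i) 1]].

Lemma splits_rank1_0 : splits_rank1 0 [set 0] [set: G].
Proof.
split; [by apply: direct_sum2_zerol|exact: finite_rank_set0|].
exists void, (fun=> set0); split=> [||[]]; [exact: card_void|exact: direct_sum_void].
Qed.

Lemma splits_rank1S k A H :
  splits_rank1 k A H -> ~ clipped H -> exists A' H', splits_rank1 k.+1 A' H'.
Proof.
move=> [dG fA [I [F [Ik dA F1]]]] /contrapT[R [[K dH] R1]].
have [A' [dA' dG']] := direct_sum2_assoc dG dH; have [_ sR _ _] := dA'.
exists A', K; split=> //; first by apply: finite_rank_direct_sum2 dA' fA _; exists 1.
(* The [unit] summand of the index type carries the new [R]. *)
exists (I + unit)%type, (sum_family F (fun=> R)); split; last by case.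
  by rewrite card_sum Ik card_unit addn1.
by apply: direct_sum_sum dA' dA _; exact: direct_sum_unit.
Qed.

Lemma splits_rank1_le n k A H :
  torsion_free G ->
  (forall B : set G, direct_summand [set: G] B ->
     exists (I : eqType) (F : I -> set G), indecomposable_decomposition B F) ->
  (forall (I : eqType) (F : I -> set G),
     indecomposable_decomposition [set: G] F -> length_le F n) ->
  splits_rank1 k A H -> (k <= n)%N.
Proof.
move=> tf refine bound [dG _ [I [F [Ik dA F1]]]].
(* [H] is itself a direct summand of the group, so the hypothesis on summands decomposes it; the
   index type [J] may a priori be infinite. *)
have [J [E [dH iE]]] : exists (J : eqType) (E : J -> set G),
    indecomposable_decomposition H E.
  by apply: refine; exists A; exact: direct_sum2_sym.
have : length_le (sum_family F E) n.
  apply: bound; split; first exact: direct_sum_sum dG dA dH.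
  by case=> [i|j] /=; [apply: rank1_indecomposable => //; case: dA|exact: iE].
(* The length bound is an injection [g] of [I + J] into the integers below [n]; its restriction to
   the left copy gives [#|I| <= n]. *)
rewrite /length_le => /pcard_leP/unsquash g.
have gn i : (g (inl i) < n)%N by exact: (@funS _ _ _ _ g (inl i)).
rewrite -Ik -[leqRHS]card_ord; apply: (@leq_card _ _ (fun i => Ordinal (gn i))).
move=> i j [] gij.
have : (inl i : I + J) = inl j by apply: (@inj _ _ _ g); rewrite ?inE.
by case.
Qed.

End RankOneSummands.

Theorem proposition2p11 (G : zmodType)
  (G_tf : torsion_free G)
  (G_inf : infinite_rank [set: G])
  (G_refine : forall B : set G, direct_summand [set: G] B ->
     exists (I : eqType) (F : I -> set G), indecomposable_decomposition B F)
  (G_bound : exists n : nat, forall (I : eqType) (F : I -> set G),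
     indecomposable_decomposition [set: G] F -> length_le F n) :
  exists A H : set G,
    [/\ direct_sum2 [set: G] A H, completely_decomposable A,
        finite_rank A & clipped H].
Proof.
have [n bound] := G_bound; apply: contrapT => noAH.
(* If no complement reached is ever clipped, splitting continues from the trivial decomposition
   through every [k]; the stage [n.+1] then violates the bound. *)
have split_all k : exists A H : set G, splits_rank1 k A H.
  elim: k => [|k [A [H AH]]]; first by do 2 eexists; exact: splits_rank1_0.
  apply: (splits_rank1S AH) => cH; apply: noAH; exists A, H.
  by have [dG fA [I [F [_ dA F1]]]] := AH; split=> //; exists I, F.
have [A [H /(splits_rank1_le G_tf G_refine bound)]] := split_all n.+1.
by rewrite ltnn.
Qed.
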